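(* Let $X$ be a compact metric space and let $f: X\to X$ be a homeomorphism which is $\mu$-expansive for some Borel probability measure $\mu$ on $X$. Then $\mu(\mathrm{Per}(f))=0$, where $\mathrm{Per}(f)$ is the set of periodic points of $f$.
   Context: For a homeomorphism $f$ of a metric space $(X,d)$, $x\in X$ and $\delta>0$, put $\Gamma_\delta(x)=\{y\in X: d(f^i(x),f^i(y))\leq\delta \text{ for all } i\in\mathbb{Z}\}$. Given a Borel probability measure $\mu$ on $X$, $f$ is called $\mu$-expansive if there is $\delta>0$ such that $\mu(\Gamma_\delta(x))=0$ for all $x\in X$. A point $x\in X$ is periodic for $f$ if $f^n(x)=x$ for some integer $n\geq 1$. *)

(* Defs.v *)
From HB Require Import structures.
From mathcomp Require Import all_boot all_order all_algebra.
From mathcomp Require Import all_classical all_reals all_analysis.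

Set Implicit Arguments.
Unset Strict Implicit.
Unset Printing Implicit Defensive.

Import Order.TTheory GRing.Theory Num.Theory.

Local Open Scope classical_set_scope.
Local Open Scope ring_scope.

(* Measurable types are pointed, hence the base point: it is no restriction for
   a space that carries a probability measure, and it plays no other role. *)
#[short(type="pointedMetricType")]
HB.structure Definition PointedMetric (K : numDomainType) :=
  {M of Metric K M & Pointed M}.

Definition borel {R : realType} (X : pointedMetricType R) :=
  g_sigma_algebraType (@open X).

(* f^-1 is the two-sided inverse carried by {splitbij [set: X] >-> [set: X]}. *)
Definition homeomorphism {X : topologicalType}
    (f : {splitbij [set: X] >-> [set: X]}) : Prop :=
  continuous f /\ continuous (f^-1)%FUN.

(* Negz n denotes the integer - n.+1. *)
Definition iterz {X : Type} (f : {splitbij [set: X] >-> [set: X]})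
    (i : int) : X -> X :=
  match i with
  | Posz n => iter n f
  | Negz n => iter n.+1 (f^-1)%FUN
  end.

Definition Gamma {R : realType} {X : metricType R}
    (f : {splitbij [set: X] >-> [set: X]}) (delta : R) (x : X) : set X :=
  [set y | forall i : int, mdist (iterz f i x) (iterz f i y) <= delta].

Definition expansive {R : realType} {X : pointedMetricType R}
    (mu : probability (borel X) R)
    (f : {splitbij [set: X] >-> [set: X]}) : Prop :=
  exists2 delta : R, 0 < delta & forall x : X, mu (Gamma f delta x) = 0%E.

Definition Per {X : Type} (f : X -> X) : set X :=
  [set x | exists2 n : nat, (1 <= n)%N & iter n f x = x].

(* Main.v *)
Require Import Defs.
From mathcomp Require Import all_boot all_order all_algebra.
From mathcomp Require Import finmap.
From mathcomp Require Import all_classical all_reals all_analysis.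

(** [Per f] is the countable union over [n >= 1] of the fixed point sets of the
    iterates [f^n], so it suffices that each of these is null.  Fix [n].  On the
    fixed point set [K] of [f^n] every integer iterate of [f] agrees with one of
    [f^0], ..., [f^(n-1)] ([iterz_fixed]).  These are finitely many continuous
    maps, so points of [K] close enough to a given [x] in [K] have their whole
    orbit within [delta] of the orbit of [x]: near [x], the set [K] lies inside
    [Gamma f delta x] ([near_fixed_Gamma]), which is null by expansiveness.  As
    [K] is closed in a compact space, finitely many such neighbourhoods cover
    it, and [K] is null ([compact_negligible]). *)

Set Implicit Arguments.
Unset Strict Implicit.
Unset Printing Implicit Defensive.

Import Order.TTheory GRing.Theory Num.Theory.

Local Open Scope classical_set_scope.
Local Open Scope ring_scope.

Lemma continuous_iter (T : topologicalType) (f : T -> T) (n : nat) :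
  continuous f -> continuous (iter n f).
Proof.
move=> cf; elim: n => [|n IHn] x; first exact: cvg_id.
by apply: (@continuous_comp _ _ _ (iter n f) f); [exact: IHn | exact: cf].
Qed.

Lemma continuous_iterz (X : topologicalType)
    (f : {splitbij [set: X] >-> [set: X]}) (i : int) :
  homeomorphism f -> continuous (iterz f i).
Proof. by case: i => n [cf cfV]; exact: continuous_iter. Qed.

(** A fixed point set in a Hausdorff space is closed: at a point [x] of its
    closure, every neighbourhood of [g x] meets every neighbourhood of [x] in a
    fixed point. *)
Lemma closed_fixed (T : topologicalType) (g : T -> T) :
  hausdorff_space T -> continuous g -> closed [set x | g x = x].
Proof.
move=> hT cg x clx; apply: hT => U V gxU xV.
have gUV : nbhs x (g @^-1` U `&` V) by apply: filterI => //; exact: cg.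
have [y [gy [gyU yV]]] := clx _ gUV.
by exists y; split=> //; rewrite -gy.
Qed.

Lemma closed_mdist_ball (R : realType) (X : metricType R) (a : X) (delta : R) :
  closed [set y | mdist a y <= delta].
Proof.
move=> y cly /=; apply/ler_addgt0Pl => e e0.
have [z [/= az]] := cly _ (nbhsx_ballx y e e0).
rewrite ballEmdist/= metric_sym => zy.
by rewrite (le_trans (metric_triangle a z y))// addrC lerD// ltW.
Qed.

(** This makes [Gamma f delta x] a Borel set, so that its being of measure zero
    passes to its subsets. *)
Lemma closed_Gamma (R : realType) (X : metricType R)
    (f : {splitbij [set: X] >-> [set: X]}) (delta : R) (x : X) :
  homeomorphism f -> closed (Gamma f delta x).
Proof.
move=> hf.
have -> : Gamma f delta x = \bigcap_(i in [set: int])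
    (iterz f i @^-1` [set y | mdist (iterz f i x) y <= delta]).
  by apply/seteqP; split=> [y xy i _|y xy i]; [exact: xy | exact: (xy i)].
apply: closed_bigI => i _.
have /continuous_closedP := @continuous_iterz _ f i hf.
by apply; exact: closed_mdist_ball.
Qed.

Lemma measurable_borel_open (R : realType) (X : pointedMetricType R)
    (A : set X) : open A -> measurable (A : set (borel X)).
Proof. by move=> oA; exact: sub_sigma_algebra. Qed.

Lemma measurable_borel_closed (R : realType) (X : pointedMetricType R)
    (A : set X) : closed A -> measurable (A : set (borel X)).
Proof.
move=> cA; rewrite -[A]setCK; apply: measurableC.
by apply: measurable_borel_open; exact: closed_openC.
Qed.

Lemma iter_splitinvK (X : Type) (f : {splitbij [set: X] >-> [set: X]}) (m : nat) :
  cancel (iter m f) (iter m (f^-1)%FUN).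
Proof.
move=> x; elim: m => [//|m IHm].
by rewrite iterSr iterS funK ?inE.
Qed.

Lemma iter_fixedM (X : Type) (f : X -> X) (n m : nat) (y : X) :
  iter n f y = y -> iter (m * n) f y = y.
Proof. by move=> fy; rewrite iterM iter_fix. Qed.

(** The exponent [k] is chosen uniformly in [y]; it is the residue of [i]
    modulo [n], negative exponents being shifted by a multiple of [n] first. *)
Lemma iterz_fixed (X : Type) (f : {splitbij [set: X] >-> [set: X]}) (n : nat)
    (i : int) : (0 < n)%N ->
  exists k : 'I_n, forall y, iter n f y = y -> iterz f i y = iter k f y.
Proof.
move=> n0.
have red m : exists k : 'I_n,
    forall y, iter n f y = y -> iter m f y = iter k f y.
  exists (Ordinal (ltn_pmod m n0)) => y fy /=.
  by rewrite {1}(divn_eq m n) addnC iterD iter_fixedM.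
case: i => m; first exact: red.
have [k kP] := red (m.+1 * n.-1)%N.
exists k => y fy; rewrite -kP// -[LHS]/(iter m.+1 (f^-1)%FUN y).
(* y = f^((m+1) n) y = f^(m+1) (f^((m+1) (n-1)) y) *)
rewrite -[y in LHS](iter_fixedM m.+1 fy) -{1}(prednK n0) mulnS iterD.
exact: iter_splitinvK.
Qed.

(** By [iterz_fixed], among the fixed points of [f^n] the infinitely many
    conditions defining [Gamma] reduce to [n] of them, and finitely many
    continuous maps admit a common neighbourhood of [x]. *)
Lemma near_fixed_Gamma (R : realType) (X : metricType R)
    (f : {splitbij [set: X] >-> [set: X]}) (delta : R) (n : nat) (x : X) :
  continuous f -> 0 < delta -> (0 < n)%N -> iter n f x = x ->
  \forall y \near x, iter n f y = y -> Gamma f delta x y.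
Proof.
move=> cf d0 n0 fx.
have : \forall y \near x, forall k : 'I_n,
    mdist (iter k f x) (iter k f y) <= delta.
  apply: filter_forall => k.
  apply: metricType_numDomainType.cvgr_dist_le d0.
  exact: continuous_iter.
apply: filterS => y xy fy i.
by have [k kP] := iterz_fixed f i n0; rewrite !kP.
Qed.

(** Being null is a local property of a compact set, as finite unions of null
    sets are null. *)
Lemma compact_negligible (R : realType) (X : pointedMetricType R)
    (mu : {measure set (borel X) -> \bar R}) (K : set X) : compact K ->
  (forall x, K x -> exists2 N : set X,
     mu.-negligible (N : set (borel X)) & \forall y \near x, K y -> N y) ->
  mu.-negligible (K : set (borel X)).
Proof.
rewrite compact_cover => cK Kloc.
pose D := [set U : set X | open U /\ mu.-negligible (U `&` K : set (borel X))].
have [|x Kx|D' D'D KD'] := cK _ D id; first by move=> U [].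
- have [N N0 xN] := Kloc x Kx.
  exists (interior [set y | K y -> N y]) => //=; split.
    exact: open_interior.
  by apply: negligibleS N0 => y [/interior_subset/= + Ky]; exact.
- have D'0 : mu.-negligible
      (\big[setU/set0]_(U <- D') (U `&` K) : set (borel X)).
    rewrite big_seq; elim/big_ind : _ => [||U UD'].
    + exact: negligible_set0.
    + exact: (@negligibleU _ (borel X)).
    + by have := D'D U UD'; rewrite inE => -[].
  apply: negligibleS D'0 => y Ky.
  have [U UD' Uy] := KD' y Ky.
  by rewrite -bigcup_fset; exists U.
Qed.

Theorem corollary4p4 (R : realType) (X : pointedMetricType R)
  (compactX : compact [set: X])
  (f : {splitbij [set: X] >-> [set: X]}) (homeo_f : homeomorphism f)
  (mu : probability (borel X) R) (expansive_f : expansive mu f) :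
  mu (Per f) = 0%E.
Proof.
have [delta d0 G0] := expansive_f; have [cf _] := homeo_f.
pose K n : set (borel X) := [set x : X | iter n.+1 f x = x].
have Kcl n : closed (K n : set X).
  exact/closed_fixed/continuous_iter/cf/metric_hausdorff.
have PerE : Per f = \bigcup_n K n.
  by apply/seteqP; split=> [x [[//|n] _ fx]|x [n _ fx]];
    [exists n | exists n.+1].
rewrite PerE; apply: measure_negligible.
  by apply: bigcupT_measurable => n; exact: measurable_borel_closed.
apply: negligible_bigcup => n; apply: compact_negligible.
  exact: subclosed_compact (Kcl n) compactX _.
move=> x Kx; exists (Gamma f delta x); last first.
  exact: (@near_fixed_Gamma _ _ _ _ n.+1).
apply/negligibleP; last exact: G0.
by apply: measurable_borel_closed; exact: closed_Gamma.
Qed.
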